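(* Let $R_n$ be a regular hexagon with side length $n$ in the triangular lattice. Then the minimum maximum excess of $R_n$, taken over all orderings of the black triangles of $R_n$, is equal to $n$.
   Context: The triangular lattice tiles the plane by unit equilateral triangles; upward-pointing triangles are black and downward-pointing triangles are white. $R_n$ is the union of lattice triangles forming a regular hexagon with side length $n$. For a set $U$ of black triangles of $R_n$, $N(U)$ is the set of white triangles of $R_n$ sharing an edge with at least one triangle of $U$, and the excess is $e(U)=|N(U)|-|U|$. For an ordering $b_1,\dots,b_m$ of all black triangles of $R_n$, let $B_k=\{b_1,\dots,b_k\}$; the maximum excess of the ordering is $\max_{1\le k\le m} e(B_k)$. The minimum maximum excess of $R_n$ is the minimum of the maximum excess over all orderings of the black triangles. *)

(* Defs.v *)
From mathcomp Require Import all_boot all_order all_algebra.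
From mathcomp Require Import finmap.
From mathcomp Require Import zify.

Set Implicit Arguments.
Unset Strict Implicit.
Unset Printing Implicit Defensive.

Import Order.TTheory GRing.Theory Num.Theory.
Local Open Scope fset_scope.
Local Open Scope ring_scope.

(* The lattice point (x, y) stands for x u + y v in the plane, where
   u = (1, 0) and v = (1/2, sqrt 3 / 2) are the unit lattice vectors. *)
Definition point : Type := (int * int)%type.

(* (c, (a, b)) is one of the two triangles of the unit rhombus with corner
   (a, b) and sides u, v: the upward-pointing (black) one if c = true, the
   downward-pointing (white) one if c = false. *)
Definition triangle : Type := (bool * point)%type.

Definition is_black (t : triangle) : bool := t.1.

Definition vertices (t : triangle) : seq point :=
  let: (c, (a, b)) := t in
  if c then [:: (a, b); (a + 1, b); (a, b + 1)]
  else [:: (a + 1, b); (a, b + 1); (a + 1, b + 1)].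

(* An edge is determined by its two endpoints. *)
Definition share_edge (t u : triangle) : bool :=
  count (fun p => p \in vertices u) (vertices t) == 2%N.

(* The regular hexagon with centre 0 and corners n u, n v, n (v - u), - n u,
   - n v, n (u - v). *)
Definition point_in_hexagon (n : nat) (p : point) : bool :=
  [&& `|p.1| <= n%:Z, `|p.2| <= n%:Z & `|p.1 + p.2| <= n%:Z].

(* The hexagon being convex, a triangle lies in it iff its vertices do. *)
Definition triangle_in_hexagon (n : nat) (t : triangle) : bool :=
  all (point_in_hexagon n) (vertices t).

(* The box only serves to make hexagon n a finite set; see [in_hexagon]. *)
Definition box (n : nat) : seq triangle :=
  let I := [seq i%:Z - n%:Z | i <- iota 0 (2 * n).+1] in
  [seq (c, p) | c <- [:: true; false], p <- [seq (a, b) | a <- I, b <- I]].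

Definition hexagon (n : nat) : {fset triangle} :=
  [fset t in box n | triangle_in_hexagon n t].

Definition black (n : nat) : {fset triangle} :=
  [fset t in hexagon n | is_black t].
Definition white (n : nat) : {fset triangle} :=
  [fset t in hexagon n | ~~ is_black t].

Definition neighbours (n : nat) (U : {fset triangle}) : {fset triangle} :=
  [fset w in white n | [exists b : U, share_edge (val b) w]].

Definition excess (n : nat) (U : {fset triangle}) : int :=
  #|` neighbours n U|%:Z - #|` U|%:Z.

Definition prefix_set (s : seq triangle) (k : nat) : {fset triangle} :=
  [fset t in take k s].

(* The default e(B_1) of the iterated maximum is one of its terms when s is
   nonempty, so that this is the maximum of e(B_k) over 1 <= k <= size s. *)
Definition max_excess (n : nat) (s : seq triangle) : int :=
  \big[Order.max/excess n (prefix_set s 1)]_(1 <= k < (size s).+1)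
    excess n (prefix_set s k).

(* [permutations (black n)] lists all orderings of the black triangles; the
   default of the iterated minimum is the value at one of them. *)
Definition min_max_excess (n : nat) : int :=
  \big[Order.min/max_excess n (black n)]_(s <- permutations (black n))
    max_excess n s.

Lemma in_hexagon (n : nat) (t : triangle) :
  (t \in hexagon n) = triangle_in_hexagon n t.
Proof.
rewrite !in_fset; case: t => c [a b]; rewrite inE; apply: andb_idl => tR.
have [ha hb] : (`|a| <= n%:Z) /\ (`|b| <= n%:Z).
  by move: tR; rewrite /triangle_in_hexagon /point_in_hexagon; case: c => /=; lia.
have mI (x : int) : `|x| <= n%:Z ->
    x \in [seq i%:Z - n%:Z | i <- iota 0 (2 * n).+1].
  move=> hx; apply/mapP; exists (absz (x + n%:Z)); last by lia.
  by rewrite mem_iota; lia.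
apply: (allpairs_f (fun c p => (c, p))); first by case: (c).
by apply: (allpairs_f (fun a b => (a, b))); apply: mI.
Qed.

Lemma share_edge_black_white (a b c d : int) :
  share_edge (true, (a, b)) (false, (c, d)) =
  ((c, d) \in [:: (a, b); (a - 1, b); (a, b - 1)]).
Proof.
rewrite /share_edge /= !inE !xpair_eqE.
have [[x ->] [y ->]] : (exists x, c = a + x) /\ (exists y, d = b + y).
  by split; [exists (c - a) | exists (d - b)]; lia.
have e2 (u v : int) : (u == u + v + 1) = (v == - 1) by lia.
have e3 (u v : int) : (u == u + v) = (v == 0) by lia.
have e4 (u v : int) : (u + 1 == u + v + 1) = (v == 0) by lia.
have e5 (u v : int) : (u + 1 == u + v) = (v == 1) by lia.
have e6 (u v : int) : (u + v == u) = (v == 0) by lia.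
have e7 (u v : int) : (u + v == u - 1) = (v == - 1) by lia.
rewrite !(e2, e3, e4, e5, e6, e7).
have excl (u : int) : [&& ~~ ((u == 0) && (u == 1)),
    ~~ ((u == 0) && (u == - 1)) & ~~ ((u == 1) && (u == - 1))] by lia.
move: (excl x) (excl y).
by case: (x == 0); case: (x == 1); case: (x == - 1);
   case: (y == 0); case: (y == 1); case: (y == - 1).
Qed.

Lemma orderingP (n : nat) (s : seq triangle) :
  reflect (uniq s /\ s =i black n) (s \in permutations (black n)).
Proof.
have ub : uniq (black n) by exact: fset_uniq.
rewrite mem_permutations; apply: (iffP idP) => [e|[us e]].
  by split; [rewrite (perm_uniq e) | apply: perm_mem].
exact: uniq_perm.
Qed.

(* Main.v *)
(* Cut R_n into rows of triangles parallel to one of the three directions.  A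
   set U meeting all n rows that start and end with white triangles, and
   containing no full row of black triangles among the n others, has excess at
   least n.  In any ordering, stop as soon as some row of the second kind, in
   any direction, is full.  This row crosses every row of the first kind in the
   other two directions, and in at least one of these directions no row of the
   second kind is full yet, so the excess is at least n.  Conversely, in the
   lexicographic order the excess never exceeds n. *)

Require Import Defs.
From mathcomp Require Import all_boot all_order all_algebra.
From mathcomp Require Import finmap zify.

Import Order.TTheory GRing.Theory Num.Theory.
Local Open Scope fset_scope.
Local Open Scope ring_scope.

(** * Triangles of the hexagon in coordinates *)

Lemma in_black (n : nat) (c : bool) (a b : int) :
  ((c, (a, b)) \in black n) =
  [&& c, - n%:Z <= a < n%:Z, - n%:Z <= b < n%:Z & - n%:Z <= a + b < n%:Z].
Proof.
rewrite in_fset inE /= in_hexagon /triangle_in_hexagon /is_black.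
by case: c; rewrite /point_in_hexagon /= ?andbF //; apply/idP/idP; lia.
Qed.

Lemma in_white (n : nat) (c : bool) (a b : int) :
  ((c, (a, b)) \in white n) =
  [&& ~~ c, - n%:Z <= a < n%:Z, - n%:Z <= b < n%:Z
    & - n%:Z - 1 <= a + b < n%:Z - 1].
Proof.
rewrite in_fset inE /= in_hexagon /triangle_in_hexagon /is_black.
by case: c; rewrite /point_in_hexagon /= ?andbF //; apply/idP/idP; lia.
Qed.

Lemma in_neighbours (n : nat) (U : {fset triangle}) (c : bool) (x y : int) :
  U `<=` black n ->
  ((c, (x, y)) \in neighbours n U) =
  ((c, (x, y)) \in white n) &&
    [|| (true, (x, y)) \in U, (true, (x + 1, y)) \in U
      | (true, (x, y + 1)) \in U].
Proof.
move=> /fsubsetP sU; rewrite in_fset inE /=; apply: andb_id2l.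
rewrite in_white => /andP[/negbTE -> _].
apply/existsP/or3P => [[[[c' [a b]] /= bU]]|].
  have := sU _ bU; rewrite in_black => /andP[c't _].
  rewrite c't in bU *; rewrite share_edge_black_white !inE.
  by case/or3P => /eqP[-> ->]; [constructor 1|constructor 2|constructor 3];
     rewrite ?subrK.
by case=> h; exists [` h]; rewrite /= share_edge_black_white !inE ?addrK eqxx
  ?orbT.
Qed.

(** * Rotation symmetry *)

(** The rotation by 120 degrees about the centre. The third row coordinate brings the coordinate sum
    to -1 for a black triangle and to -2 for a white one; the rotation permutes the three
    coordinates cyclically. *)
Definition rotate (t : triangle) : triangle :=
  let: (c, (a, b)) := t in (c, (b, (if c then - 1 else - 2) - a - b)).

Lemma rotateK (t : triangle) : rotate (rotate (rotate t)) = t.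
Proof. by case: t => [[] [a b]] /=; congr (_, (_, _)); lia. Qed.

Lemma rotate_inj : injective rotate.
Proof.
by apply: (@can_inj _ _ _ (fun t => rotate (rotate t))) => t; apply: rotateK.
Qed.

Lemma in_rotate (U : {fset triangle}) (t : triangle) :
  (t \in rotate @` U) = (rotate (rotate t) \in U).
Proof. by rewrite -{1}(rotateK t) (mem_imfset _ _ rotate_inj). Qed.

Lemma rotate_fset3 (U : {fset triangle}) :
  rotate @` (rotate @` (rotate @` U)) = U.
Proof. by apply/fsetP => t; rewrite !in_rotate !rotateK. Qed.

Lemma rotate_black (n : nat) : rotate @` black n = black n.
Proof.
by apply/fsetP => -[[] [a b]]; rewrite in_rotate !in_black //=;
  apply/idP/idP; lia.
Qed.

Lemma rotate_sub_black (n : nat) (U : {fset triangle}) :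
  U `<=` black n -> rotate @` U `<=` black n.
Proof.
by move=> sU; rewrite -(rotate_black n); apply: subset_imfset; apply/fsubsetP.
Qed.

Lemma rotate_neighbours (n : nat) (U : {fset triangle}) :
  U `<=` black n -> neighbours n (rotate @` U) = rotate @` neighbours n U.
Proof.
move=> sU; apply/fsetP => -[c [a b]].
rewrite in_rotate in_neighbours ?rotate_sub_black // in_white.
case: c => /=; rewrite in_neighbours // in_white //=; congr (_ && _).
  by apply/idP/idP; lia.
rewrite !in_rotate /= orbA orbC.
by congr [|| _, _ | _]; congr (_ \in U); congr (_, (_, _)); lia.
Qed.

Lemma rotate_excess (n : nat) (U : {fset triangle}) :
  U `<=` black n -> excess n (rotate @` U) = excess n U.
Proof.
move=> sU; rewrite /excess rotate_neighbours //.
by rewrite !(card_imfset _ _ rotate_inj).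
Qed.

(** * Lower bound *)

(* A row of fixed first coordinate x alternates black and white triangles.  If
   x < 0 it starts and ends with white ones; if x >= 0, with black ones.  With
   m x chosen in U, resp. outside U, sending each triangle of U to the
   neighbour on the far side of m x, resp. on the near side, is injective; in
   the rows x < 0, one more neighbour of m x is left over. *)
Lemma excess_ge_rows (n : nat) (U : {fset triangle}) :
  U `<=` black n ->
  (forall x, exists y, (- n%:Z <= x < n%:Z) ==>
    ((true, (x, y)) \in black n) && (((true, (x, y)) \in U) == (x < 0))) ->
  n%:Z <= excess n U.
Proof.
(* The range condition sits under the existential, so rows outside the hexagon have a witness too
   and [m] is total. *)
move=> sU hm; pose m x := xchoose (hm x).
have mP x : - n%:Z <= x < n%:Z -> (true, (x, m x)) \in black n /\
    ((true, (x, m x)) \in U) = (x < 0).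
  by move=> hx; have /implyP/(_ hx)/andP[? /eqP] := xchooseP (hm x).
pose f (t : triangle) : triangle :=
  let: (_, (x, y)) := t in
  (false, (x, if (if x < 0 then y <= m x else m x < y) then y - 1 else y)).
pose e (i : nat) : triangle := (false, (- (i.+1)%:Z, m (- (i.+1)%:Z))).
pose E := [fset e i | i in iota 0 n].
have UP c x y : (c, (x, y)) \in U ->
    [/\ c, - n%:Z <= x < n%:Z, - n%:Z <= y < n%:Z, - n%:Z <= x + y < n%:Z
      & (x < 0) || (y != m x)].
  move=> tU; have := fsubsetP sU _ tU; rewrite in_black => /and4P[hc h1 h2 h3].
  split=> //; have [_] := mP _ h1; case: ltP => //= hx hU.
  by apply: contraFN hU => /eqP <-; rewrite hc in tU.
have f_inj : {in U &, injective f}.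
  move=> [c [x y]] [c' [x' y']] /UP[-> h1 h2 h3 h4] /UP[-> h1' h2' h3' h4'] [].
  move=> exx; subst x'; move=> h; congr (_, (_, _)); move: h h4 h4'.
  by move: (m x) => mx; case: (ltP x 0) => _ /=; case: ifP; case: ifP; lia.
have e_inj : injective e by move=> i j [] h _; lia.
have cE : #|` E| = n.
  by rewrite (card_imfset _ _ e_inj) /= undup_id ?size_iota ?iota_uniq.
have cF : #|` f @` U| = #|` U| by apply/eqP/card_in_imfsetP.
have dEF : [disjoint f @` U & E].
  apply/fdisjointP => t /imfsetP[[c [x y]] /= /UP[_ _ _ _ h] ->].
  apply/negP => /imfsetP[i _ [hx]]; move: h; rewrite -hx.
  by case: ltP => [_ _|] /=; [case: ifP|]; lia.
have sN : f @` U `|` E `<=` neighbours n U.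
  apply/fsubsetP => t; rewrite in_fsetU => /orP[] /imfsetP /=.
    case=> -[c [x y]] tU -> /=; have [hc h1 h2 h3 h4] := UP _ _ _ tU.
    rewrite hc in tU; have [hb hmU] := mP _ h1.
    move: hb; rewrite in_black in_neighbours // in_white.
    by case: (ltP x 0) h4 => hx /= h4; case: ifP => hif /= hb;
      rewrite ?subrK tU ?orbT andbT; move: h1 h2 h3 h4 hif hb {hmU}; lia.
  case=> i; rewrite mem_iota => hi ->; rewrite in_neighbours // in_white.
  have hx : - n%:Z <= - (i.+1)%:Z < n%:Z by lia.
  have [hb hU] := mP _ hx; rewrite in_black in hb.
  by rewrite hU /=; move: hb; lia.
have := fsubset_leq_card sN; have := leq_card_fsetU (f @` U) E.
by rewrite dEF => -[_ /eqP ->]; rewrite cE cF /excess; lia.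
Qed.

Definition has_full_row (n : nat) (U : {fset triangle}) : bool :=
  has (fun x => all (fun b : triangle => (b.2.1 == x) ==> (b \in U)) (black n))
    [seq x%:Z | x <- iota 0 n].

Lemma has_full_rowP (n : nat) (U : {fset triangle}) :
  reflect (exists2 x : int, 0 <= x < n%:Z &
             forall y, (true, (x, y)) \in black n -> (true, (x, y)) \in U)
    (has_full_row n U).
Proof.
apply: (iffP hasP) => [[x /mapP[i]]|[x hx h]].
  rewrite mem_iota => hi -> /allP h; exists i%:Z; first by lia.
  by move=> y /h; rewrite eqxx.
exists x; first by apply/mapP; exists (absz x); rewrite ?mem_iota; lia.
apply/allP => -[c [a b]] hb; apply/implyP => /= /eqP ax; subst a.
by move: hb; case: c => [/h|]; rewrite // in_black.
Qed.

Lemma excess_ge_no_full_row (n : nat) (U : {fset triangle}) :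
  U `<=` black n -> ~~ has_full_row n U ->
  (forall x, - n%:Z <= x < 0 -> exists y, (true, (x, y)) \in U) ->
  n%:Z <= excess n U.
Proof.
move=> sU nF hm; apply: excess_ge_rows => // x.
have [x0|x0] := ltP x 0.
  have [xn|xn] := leP (- n%:Z) x; last by exists 0; apply/implyP; lia.
  have [|y hy] := hm x; first by lia.
  by exists y; rewrite hy (fsubsetP sU _ hy) implybT.
have [xn|xn] := ltP x n%:Z; last by exists 0; apply/implyP; lia.
have: has (fun b : triangle => (b.2.1 == x) && (b \notin U)) (black n).
  apply: contraNT nF => /hasPn h; apply/has_full_rowP; exists x; first by lia.
  by move=> y /h; rewrite eqxx /= negbK.
case/hasP => -[c [a b]] hb /andP[/= /eqP ax nU]; subst a.
have hc : c = true by move: hb; rewrite in_black => /andP[].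
by rewrite hc in hb nU; exists b; rewrite hb (negbTE nU) implybT.
Qed.

(** Rotating once or twice turns lines of fixed second or third coordinate into rows. *)
Definition has_full_line (n : nat) (U : {fset triangle}) : bool :=
  [|| has_full_row n U, has_full_row n (rotate @` U)
    | has_full_row n (rotate @` (rotate @` U))].

Lemma has_full_line_rotate (n : nat) (U : {fset triangle}) :
  has_full_line n (rotate @` U) = has_full_line n U.
Proof. by rewrite /has_full_line rotate_fset3 orbA orbC. Qed.

(** Only the row of the added triangle changes, and only rows of nonnegative index count as full. *)
Lemma new_full_row (n : nat) (U : {fset triangle}) (c : bool) (a b : int) :
  ~~ has_full_row n U -> has_full_row n ((c, (a, b)) |` U) -> 0 <= a.
Proof.
move=> nF /has_full_rowP[x hx h]; rewrite leNgt; apply: contra nF => a0.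
apply/has_full_rowP; exists x => // y /h; rewrite in_fset1U => /orP[/eqP[]|//].
by lia.
Qed.

(* A full row x >= 0 of black triangles crosses all negative rows of the other
   two directions.  The new triangle cannot complete lines in all three
   directions, as the sum of its three coordinates is -1. *)
Lemma excess_ge_new_full_row (n : nat) (U : {fset triangle}) (b : triangle) :
  b |` U `<=` black n -> ~~ has_full_line n U -> has_full_row n (b |` U) ->
  n%:Z <= excess n (b |` U).
Proof.
move=> sV; rewrite /has_full_line !negb_or => /and3P[nF0 nF1 nF2] F0.
case: b => c [a b] in sV F0 *.
have hc : c.
  have := fsubsetP sV (c, (a, b)); rewrite fset1U1 in_black.
  by case/(_ isT)/andP.
rewrite {c}hc in sV F0 *.
set V := _ |` U in sV F0 *.
have [x hx hV] := has_full_rowP _ _ F0.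
have a0 := new_full_row _ _ _ _ _ nF0 F0.
have rV : rotate @` V = rotate (true, (a, b)) |` rotate @` U.
  by rewrite imfsetU1.
have rrV : rotate @` (rotate @` V) =
    rotate (rotate (true, (a, b))) |` rotate @` (rotate @` U).
  by rewrite rV imfsetU1.
have [F1|F1] := boolP (has_full_row n (rotate @` V)).
  rewrite -(rotate_excess _ _ sV) -rotate_excess ?rotate_sub_black //.
  apply: excess_ge_no_full_row; rewrite ?rotate_sub_black //.
    apply/negP; rewrite rrV => F2; rewrite rV in F1.
    have := new_full_row _ _ _ _ _ nF1 F1.
    by have := new_full_row _ _ _ _ _ nF2 F2; lia.
  (* After two rotations the coordinates read (third, first), so row [z] meets the full row at
     [(z, x)]. As [z < 0 <= x], the remaining coordinate stays in range. *)
  move=> z hz; exists x; rewrite !in_rotate /=.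
  rewrite (_ : - 1 - _ - _ = x); last by lia.
  by apply: hV; rewrite in_black; lia.
rewrite -(rotate_excess _ _ sV).
apply: excess_ge_no_full_row; rewrite ?rotate_sub_black //.
move=> y hy; exists (- 1 - x - y); rewrite !in_rotate /=.
rewrite (_ : - 1 - y - _ = x); last by lia.
rewrite (_ : - 1 - (- 1 - x - y) - x = y); last by lia.
by apply: hV; rewrite in_black; lia.
Qed.

(** A rotation preserves the excess and makes the completed line a row. *)
Lemma excess_ge_new_full_line (n : nat) (U : {fset triangle}) (b : triangle) :
  b |` U `<=` black n -> ~~ has_full_line n U -> has_full_line n (b |` U) ->
  n%:Z <= excess n (b |` U).
Proof.
move=> sV nU.
have rV : rotate @` (b |` U) = rotate b |` rotate @` U by rewrite imfsetU1.
have rrV : rotate @` (rotate @` (b |` U)) =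
    rotate (rotate b) |` rotate @` (rotate @` U) by rewrite rV imfsetU1.
have sV1 := rotate_sub_black _ _ sV; have sV2 := rotate_sub_black _ _ sV1.
case/or3P => F; first exact: excess_ge_new_full_row.
  rewrite -(rotate_excess _ _ sV) rV; rewrite rV in sV1 F.
  by apply: excess_ge_new_full_row; rewrite ?has_full_line_rotate.
rewrite -(rotate_excess _ _ sV) -rotate_excess // rrV; rewrite rrV in sV2 F.
by apply: excess_ge_new_full_row; rewrite ?has_full_line_rotate.
Qed.

Lemma max_excess_ge (n : nat) (s : seq triangle) :
  (0 < n)%N -> s \in permutations (black n) -> n%:Z <= max_excess n s.
Proof.
move=> n0 /orderingP[us es].
have sub k : prefix_set s k `<=` black n.
  by apply/fsubsetP => t; rewrite in_fset => /mem_take; rewrite es.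
have ex : exists k, has_full_line n (prefix_set s k).
  exists (size s); apply/or3P/Or31/has_full_rowP; exists 0; first by lia.
  by move=> y; rewrite -es => ys; rewrite in_fset take_size.
case: (ex_minnP ex) => -[|k] Fk kmin.
  suff : ~~ has_full_line n (prefix_set s 0) by rewrite Fk.
  rewrite /has_full_line (_ : prefix_set s 0 = fset0); last first.
    by apply/fsetP => t; rewrite in_fset take0.
  (* Row [x] contains the black triangle [(x, -x)], so the empty prefix has no full row. *)
  rewrite !imfset0 !orbb; apply/has_full_rowP => -[x hx /(_ (- x))].
  by rewrite in_black in_fset0 => h; suff: false by []; apply: h; lia.
have nFk : ~~ has_full_line n (prefix_set s k).
  by apply/negP => /kmin; rewrite ltnn.
(* Past [size s] prefixes no longer grow, so [k.+1] is an index of the maximum. *)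
have [ks|ks] := ltnP k (size s); last first.
  move: nFk Fk; rewrite /prefix_set !take_oversize // ?(leqW ks) //.
  by move=> /negbTE ->.
have eqV : prefix_set s k.+1 = nth (true, (0, 0)) s k |` prefix_set s k.
  apply/fsetP => t; rewrite in_fset in_fset1U in_fset.
  by rewrite (take_nth (true, (0, 0))) // mem_rcons inE.
apply: (@bigmax_sup_seq _ _ _ _ _ k.+1) => //.
  by rewrite mem_index_iota.
by rewrite eqV; apply: excess_ge_new_full_line; rewrite -?eqV.
Qed.

(** * Upper bound by the lexicographic order *)

Definition lex_le (t u : triangle) : bool :=
  (t.2.1 < u.2.1) || (t.2.1 == u.2.1) && (t.2.2 <= u.2.2).

Lemma lex_le_total : total lex_le.
Proof. by move=> [c [a b]] [c' [a' b']]; rewrite /lex_le /=; lia. Qed.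

Lemma lex_le_trans : transitive lex_le.
Proof.
by move=> [c [a b]] [c' [a' b']] [c'' [a'' b'']]; rewrite /lex_le /=; lia.
Qed.

(* The white triangle at (x, y) is adjacent to the black triangle at (x, y) and
   to lexicographically larger ones.  That black triangle lies in the hexagon,
   unless (x, y) is one of the n positions with x + y = - n - 1. *)
Lemma excess_le_lex_closed (n : nat) (U : {fset triangle}) :
  U `<=` black n ->
  (forall t u, t \in black n -> u \in U -> lex_le t u -> t \in U) ->
  excess n U <= n%:Z.
Proof.
move=> sU cU.
pose f (t : triangle) : triangle := (false, t.2).
pose e (i : nat) : triangle := (false, (- (i.+1)%:Z, i%:Z - n%:Z)).
pose E := [fset e i | i in iota 0 n].
have cE : (#|` E| <= n)%N.
  apply: leq_trans (leq_imfset_card _ _ _) _ => /=.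
  by rewrite undup_id ?size_iota ?iota_uniq.
have cF : (#|` f @` U| <= #|` U|)%N by apply: leq_imfset_card.
suff sN : neighbours n U `<=` f @` U `|` E.
  have := fsubset_leq_card sN; have [] := leq_card_fsetU (f @` U) E.
  by rewrite /excess; lia.
apply/fsubsetP => -[c [x y]]; rewrite in_neighbours // in_white in_fsetU.
case/andP => /and4P[/negbTE -> hx hy hxy] hU; apply/orP.
have [xy|xy] := eqVneq (x + y) (- n%:Z - 1); [right|left]; apply/imfsetP.
  exists (absz (- x - 1)); rewrite /= ?mem_iota; first by lia.
  by congr (_, (_, _)); lia.
exists (true, (x, y)) => //=.
have hb : (true, (x, y)) \in black n by rewrite in_black; lia.
by case/or3P: hU => // h; apply: (cU _ _ hb h); rewrite /lex_le /=; lia.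
Qed.

Lemma max_excess_lex (n : nat) :
  max_excess n (sort lex_le (black n)) <= n%:Z.
Proof.
set s := sort _ _.
have es : s =i black n by move=> t; rewrite mem_sort.
have pw : pairwise lex_le s.
  by rewrite -(sorted_pairwise lex_le_trans); apply: sort_sorted lex_le_total _.
have le_n k : excess n (prefix_set s k) <= n%:Z.
  have sub : prefix_set s k `<=` black n.
    by apply/fsubsetP => t; rewrite in_fset => /mem_take; rewrite es.
  apply: excess_le_lex_closed => // t u tb uk tu.
  have: t \in take k s ++ drop k s by rewrite cat_take_drop es.
  rewrite mem_cat => /orP[|td]; first by rewrite in_fset.
  have ut : lex_le u t.
    move: pw uk; rewrite -{1}(cat_take_drop k s) pairwise_cat in_fset.
    by case/and3P => /allrelP h _ _ uk; apply: h.
  (* [lex_le] ignores colours, so antisymmetry holds only because both triangles are black. *)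
  suff -> : t = u by [].
  move: tb (fsubsetP sub _ uk) tu ut; case: t {td} => c [a b].
  case: u {uk} => c' [a' b']; rewrite !in_black /lex_le /=.
  by move=> /andP[-> _] /andP[-> _] tu ut; congr (_, (_, _)); lia.
by apply: bigmax_le.
Qed.

Theorem theorem4p4 (n : nat) (hn : (0 < n)%N) : min_max_excess n = n%:Z.
Proof.
apply/eqP; rewrite eq_le; apply/andP; split.
  apply: (bigmin_inf_seq _ (sort lex_le (black n))) (max_excess_lex n) => //.
  by apply/orderingP; split=> [|t]; rewrite ?sort_uniq ?fset_uniq ?mem_sort.
rewrite /min_max_excess big_seq; apply: le_bigmin => [|s].
  (* The default of the minimum is bounded as well, [black n] being itself an ordering. *)
  by apply: max_excess_ge => //; apply/orderingP; split; rewrite ?fset_uniq.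
exact: max_excess_ge.
Qed.
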